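(* There is a function $\varepsilon(N)\to 0$ as $N\to\infty$ such that for every finite graph $G=(V,E)$ with exactly one (unknown) defective edge, there is a 3-stage group testing algorithm that identifies the defective edge, for every possible choice of it in $E$, using at most $\log_2|E|\,(1+\varepsilon(|E|))$ tests in total.
   Context: Group testing on a graph: $G=(V,E)$ is a finite simple graph (edges are 2-element subsets of $V$); exactly one edge of $E$ is defective. A test is an arbitrary subset $S\subseteq V$; its outcome is positive if $S$ contains at least one endpoint of the defective edge and negative otherwise. A 3-stage algorithm performs its tests in three rounds: within each round all tests are chosen simultaneously, and the tests of a round may depend only on the outcomes of the tests of earlier rounds. The total number of tests is counted in the worst case over the defective edge. *)

(* Defs.v *)
From mathcomp Require Import all_boot.
From Stdlib Require Import Reals.
Set Implicit Arguments. Unset Strict Implicit. Unset Printing Implicit Defensive.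

Section GT.
Variable T : finType.

Definition simple_edge_set (E : {set {set T}}) : Prop :=
  forall e, e \in E -> #|e| = 2.

Definition outcome (d S : {set T}) : bool := ~~ [disjoint S & d].

Record three_stage := ThreeStage {
  round1 : seq {set T};
  round2 : seq bool -> seq {set T};
  round3 : seq bool -> seq bool -> seq {set T} }.

Definition outs1 (A : three_stage) (d : {set T}) : seq bool :=
  map (outcome d) (round1 A).
Definition outs2 (A : three_stage) (d : {set T}) : seq bool :=
  map (outcome d) (round2 A (outs1 A d)).
Definition outs3 (A : three_stage) (d : {set T}) : seq bool :=
  map (outcome d) (round3 A (outs1 A d) (outs2 A d)).

Definition identifies (A : three_stage) (E : {set {set T}}) : Prop :=
  forall d d', d \in E -> d' \in E ->
    outs1 A d = outs1 A d' -> outs2 A d = outs2 A d' -> outs3 A d = outs3 A d' ->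
    d = d'.

Definition num_tests (A : three_stage) (d : {set T}) : nat :=
  size (round1 A) + size (round2 A (outs1 A d))
  + size (round3 A (outs1 A d) (outs2 A d)).
End GT.

Definition log2R (x : R) : R := (ln x / ln 2)%R.

(* Main.v *)
Require Import Defs.
From mathcomp Require Import all_boot all_order all_algebra realalg.
From mathcomp Require Import zify.
From mathcomp Require ring lra.
From Stdlib Require Import ClassicalEpsilon.
Set Implicit Arguments. Unset Strict Implicit. Unset Printing Implicit Defensive.

(** Let [|E| <= 2 ^ n], fix [s], and put [w] slightly above [n / s].  Round 1
tests the [s] sets [B j] of vertices of degree between [2 ^ (j * w)] and
[2 ^ (j.+1 * w)]; note [|B j| <= 2 ^ (n + 1 - j * w)].

If the defective edge meets two of them, round 2 finds its endpoint in the
[B j] of one of the two by binary search with [n + 1 - j * w] tests, and round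
3 finds the other endpoint among at most [2 ^ (j.+1 * w)] neighbours.

If the edge lies inside one [B j], the graph induced on [B j] has maximal
degree [D] with [D ^ 2 <= 2 ^ (n + 1 + w)].  Round 2 gives every vertex a
random word of length [k = n + 3 * w] and of a fixed weight, and learns the
disjunction of the two words at the endpoints.  The weight is the most likely
one for independent letters equal to 0 with probability [1 / sqrt 2], so that
a letter of a disjunction is a fair bit.  Up to factors polynomial in [k], two
disjoint edges then collide with probability [2 ^ - k] and two adjacent ones
with probability at most [2 ^ - (k / 2)], even given the word at the common
vertex (this is where the fixed weight matters).  By the first moment method some
choice of words leaves no large matching and no large star compatible with a
given outcome, hence boundedly many edges, which round 3 tells apart. *)

(** * Constant weight words *)

Section ConstantWeightCode.
Import Order.TTheory GRing.Theory Num.Theory ring lra.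
Variable k : nat.
Implicit Types (a b y : {ffun 'I_k -> bool}).

Definition word_or a b : {ffun 'I_k -> bool} := [ffun i => a i || b i].
Definition weight a : nat := \sum_i a i.

Lemma weight_le a : weight a <= k.
Proof.
rewrite -[X in _ <= X]card_ord -sum1_card; apply: leq_sum => i _.
exact: leq_b1.
Qed.

(** Off the support of [a] the word [b] must agree with [y], so [b] is determined by its restriction
    to that support. *)
Lemma card_word_or_fiber a y : #|[set b | word_or a b == y]| <= 2 ^ weight a.
Proof.
have -> : weight a = #|[set i | a i]|.
  by rewrite -sum1dep_card [RHS]big_mkcond; apply: eq_bigr => i _; case: (a i).
rewrite -card_powerset; pose h b := [set i | a i && b i].
rewrite -(card_in_imset (f := h)).
  apply: subset_leq_card; apply/subsetP=> _ /imsetP[b _ ->].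
  by rewrite powersetE; apply/subsetP=> i; rewrite !inE => /andP[].
move=> b b'; rewrite !inE => /eqP eb /eqP eb' /setP ehb.
apply/ffunP=> i; have := ehb i; rewrite !inE.
have := congr1 (fun z : {ffun 'I_k -> bool} => z i) eb.
have := congr1 (fun z : {ffun 'I_k -> bool} => z i) eb'.
by rewrite !ffunE; case: (a i) => //= -> ->.
Qed.

Local Open Scope ring_scope.

Section Weights.
Variable R : rcfType.
Variables p q : R.
Hypotheses (p_ge0 : 0 <= p) (q_ge0 : 0 <= q) (pq1 : p + q = 1).
Hypothesis qq : q * q = 2^-1.

Let mu (x : bool) : R := if x then p else q.

Lemma prod_word_weight a :
  \prod_i mu (a i) = p ^+ weight a * q ^+ (k - weight a).
Proof.
have card_supp : #|[pred i | a i]| = weight a.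
  by rewrite /weight -sum1_card [LHS]big_mkcond; apply: eq_bigr => i _; rewrite inE; case: (a i).
rewrite (bigID [in [pred i | a i]]) /=; congr (_ * _).
  rewrite (eq_bigr (fun=> p)) ?prodr_const ?card_supp // => i.
  by rewrite inE => ->.
rewrite (eq_bigl [in [predC [pred i | a i]]]) //.
rewrite (eq_bigr (fun=> q)) ?prodr_const => [|i]; last by rewrite !inE => /negbTE ->.
congr (_ ^+ _).
by rewrite -[k in (k - _)%N]card_ord -(cardC [pred i | a i]) card_supp addKn.
Qed.

Lemma sum_word_weight : \sum_(a : {ffun 'I_k -> bool}) \prod_i mu (a i) = 1.
Proof.
rewrite -(bigA_distr_bigA (fun (_ : 'I_k) x => mu x)) big1 // => i _.
by rewrite big_bool.
Qed.

(** Pigeonhole over the [k.+1] weight classes, whose masses add up to 1; all words of one class have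
    the same mass. *)
Lemma exists_heavy_weight : exists2 w : nat, (w <= k)%N &
  1 <= k.+1%:R * (#|[set a | weight a == w]|%:R * (p ^+ w * q ^+ (k - w))).
Proof.
pose S (w : 'I_k.+1) : R := \sum_(a : {ffun 'I_k -> bool} | weight a == w) \prod_i mu (a i).
have sumS : \sum_w S w = 1.
  rewrite -sum_word_weight.
  rewrite (partition_big (fun a => inord (weight a) : 'I_k.+1) predT) //=.
  apply: eq_bigr => w _; apply: eq_bigl => a.
  by rewrite -val_eqE /= inordK // ltnS weight_le.
have [w hw] : exists w, 1 <= k.+1%:R * S w.
  apply/existsP; apply: contraT; rewrite negb_exists => /forallP small.
  have : k.+1%:R * \sum_w S w < k.+1%:R.
    rewrite mulr_sumr -[X in _ < X%:R]card_ord -sumr_const.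
    have -> : \sum_(i in 'I_k.+1) 1 = \sum_(i < k.+1) 1 :> R by [].
    apply: ltr_sum; first by apply/hasP; exists ord0; rewrite // mem_index_enum.
    by move=> i _; rewrite ltNge small.
  by rewrite sumS mulr1 ltxx.
exists w; first by rewrite -ltnS.
move: hw; rewrite /S (eq_bigr (fun=> p ^+ w * q ^+ (k - w))).
  by rewrite sumr_const -[c in _ * c]mulr_natl cardsE.
by move=> a /eqP <-; rewrite prod_word_weight.
Qed.

(** The letters are independent, so the sum factors; by [qq] a letter of the disjunction is 0 with
    probability 1/2, hence also 1 with probability 1/2. *)
Lemma sum_or_pairs y :
  \sum_(ab : {ffun 'I_k -> bool} * {ffun 'I_k -> bool} |
        word_or ab.1 ab.2 == y)
     (\prod_i mu (ab.1 i)) * (\prod_i mu (ab.2 i)) = (2^-1) ^+ k.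
Proof.
(* The constraint becomes a factor 0, so that the restricted sum turns into a full sum to which
   distributivity applies. *)
pose F (i : 'I_k) (x : bool * bool) : R :=
  if (x.1 || x.2) == y i then mu x.1 * mu x.2 else 0.
have half i : \sum_x F i x = 2^-1.
  rewrite -(pair_bigA _ (fun u v => F i (u, v))) /= !big_bool /= /F /=.
  have -> : p = 1 - q by rewrite -pq1 addrK.
  by case: (y i) => /=; rewrite ?addr0 ?add0r //; have := qq; lra.
transitivity (\prod_(i < k) \sum_x F i x); last first.
  rewrite (eq_bigr _ (fun i _ => half i)) prodr_const card_ord //.
rewrite bigA_distr_bigA big_mkcond /=.
pose h (f : {ffun 'I_k -> bool * bool}) : {ffun 'I_k -> bool} * {ffun 'I_k -> bool} :=
  ([ffun i => (f i).1], [ffun i => (f i).2]).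
rewrite (reindex h) /=; last first.
  exists (fun ab : {ffun 'I_k -> bool} * {ffun 'I_k -> bool} =>
            [ffun i => (ab.1 i, ab.2 i)]) => [f _ | [a b] _].
    by apply/ffunP=> i; rewrite !ffunE; case: (f i).
  by congr (_, _); apply/ffunP=> i; rewrite !ffunE.
apply: eq_bigr => f _; rewrite -big_split /=.
case: eqP => [ey | ney].
  by apply: eq_bigr => i _; rewrite /F -ey !ffunE eqxx.
have [/forallP all_eq | ] := boolP [forall i, (f i).1 || (f i).2 == y i].
  by case: ney; apply/ffunP=> i; rewrite !ffunE; apply/eqP.
rewrite negb_forall => /existsP[i ne_i].
by rewrite (bigD1 i) //= /F (negbTE ne_i) mul0r.
Qed.

(** Each counted pair contributes the same mass to the sum of [sum_or_pairs], and the discarded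
    pairs contribute nonnegative mass. *)
Lemma card_or_pairs_weight y w :
  (#|[set ab : {ffun 'I_k -> bool} * {ffun 'I_k -> bool} |
      [&& weight ab.1 == w, weight ab.2 == w & word_or ab.1 ab.2 == y]]|%:R)
    * (p ^+ w * q ^+ (k - w)) ^+ 2 <= (2^-1) ^+ k.
Proof.
rewrite -(sum_or_pairs y) mulr_natl -sumr_const.
rewrite (eq_bigr (fun ab : {ffun 'I_k -> bool} * {ffun 'I_k -> bool} =>
   (\prod_i mu (ab.1 i)) * (\prod_i mu (ab.2 i)))); last first.
  by move=> ab; rewrite inE => /and3P[/eqP e1 /eqP e2 _]; rewrite !prod_word_weight e1 e2.
rewrite [X in X <= _]big_mkcond [X in _ <= X]big_mkcond.
apply: ler_sum => ab _; rewrite inE.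
have pos : 0 <= (\prod_i mu (ab.1 i)) * (\prod_i mu (ab.2 i)).
  by apply: mulr_ge0; apply: prodr_ge0 => i _; rewrite /mu; case: ifP.
by case: (word_or ab.1 ab.2 == y); rewrite ?andbT ?andbF //; case: ifP.
Qed.
End Weights.

(** Collision probabilities with denominators cleared. The second clause concerns two independent
    words; the third concerns one word given the other, [2 ^ w] being the fibre bound of
    [card_word_or_fiber], and is squared to stay within integers. *)
Lemma exists_balanced_weight : exists w,
  [/\ (0 < #|[set a | weight a == w]|)%N,
   forall y, (#|[set ab : {ffun 'I_k -> bool} * {ffun 'I_k -> bool} |
        [&& weight ab.1 == w, weight ab.2 == w & word_or ab.1 ab.2 == y]]| * 2 ^ k
      <= k.+1 ^ 2 * #|[set a | weight a == w]| ^ 2)%N &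
   (((2 ^ w) ^ 2) * 2 ^ k <= k.+1 ^ 2 * #|[set a | weight a == w]| ^ 2)%N].
Proof.
pose r : realalg := Num.sqrt 2.
have r2 : r ^+ 2 = 2 by rewrite sqr_sqrtr.
have r0 : 0 < r by rewrite sqrtr_gt0.
pose q := r^-1; pose p := 1 - q.
have rq : r * q = 1 by rewrite divff ?gt_eqF.
have q0 : 0 < q by rewrite invr_gt0.
have qq : q * q = 2^-1 by rewrite -invfM -expr2 r2.
have r32 : r <= 3 / 2 by nra.
have r1 : 1 < r by nra.
have p0 : 0 < p by rewrite subr_gt0 invf_lt1.
have pq1 : p + q = 1 by rewrite subrK.
have [w wk hw] := exists_heavy_weight pq1.
set X := #|_| in hw; set c := p ^+ w * q ^+ (k - w) in hw.
have c0 : 0 < c by rewrite mulr_gt0 // exprn_gt0.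
exists w; rewrite -/X; split.
- by rewrite lt0n; apply: contraTneq hw => ->; rewrite mul0r mulr0 -ltNge ltr01.
- move=> y; have := card_or_pairs_weight (ltW p0) (ltW q0) pq1 qq y w.
  rewrite -/c; set P := #|_| => hP.
  rewrite -(ler_nat realalg) !natrM !natrX.
  have {}hP : P%:R * 2 ^+ k * c ^+ 2 <= 1.
    rewrite mulrAC -ler_pdivlMr ?exprn_gt0 // mul1r -exprVn //.
  (* Heaviness of the class says that [k.+1 * X * c] is at least 1; its square trades [c ^+ 2] for
     [X ^+ 2]. *)
  apply: le_trans (_ : P%:R * 2 ^+ k * (k.+1%:R * (X%:R * c)) ^+ 2 <= _).
    rewrite ler_peMr ?mulr_ge0 ?exprn_ge0 ?ler0n //.
    by rewrite exprn_ege1.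
  have -> : P%:R * 2 ^+ k * (k.+1%:R * (X%:R * c)) ^+ 2 =
      (k.+1%:R ^+ 2 * X%:R ^+ 2) * (P%:R * 2 ^+ k * c ^+ 2) by ring.
  by rewrite ler_piMr // mulr_ge0 ?exprn_ge0 ?ler0n.
- have e2 : 2 ^+ k = (r ^+ k) ^+ 2 by rewrite -[in LHS]r2 -!exprM mulnC.
  rewrite -(ler_nat realalg) natrM [X in _ <= X]natrM !natrX e2 -exprMn -[X in _ <= X]exprMn.
  rewrite ler_pXn2r ?nnegrE ?mulr_ge0 ?exprn_ge0 ?ler0n ?(ltW r0) ?(ltW p0) //.
  (* Since [r * q = 1], only the factor [2 * r * p = 2 * r - 2] matters, and it is at most 1 because
     [r <= 3 / 2]. *)
  have hc : 2 ^+ w * r ^+ k * c <= 1.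
    have -> : 2 ^+ w * r ^+ k * c = (2 * r * p) ^+ w * (r * q) ^+ (k - w).
      by rewrite -{1}(subnKC wk) exprD /c !exprMn; ring.
    rewrite rq expr1n mulr1 exprn_ile1 //.
      by rewrite !mulr_ge0 ?(ltW r0) ?(ltW p0).
    by rewrite /p mulrBr mulr1 -mulrA rq; lra.
  apply: le_trans (_ : 2 ^+ w * r ^+ k * (k.+1%:R * (X%:R * c)) <= _).
    by rewrite ler_peMr ?mulr_ge0 ?exprn_ge0 ?ler0n ?(ltW r0) ?(ltW p0).
  have -> : 2 ^+ w * r ^+ k * (k.+1%:R * (X%:R * c)) =
      (k.+1%:R * X%:R) * (2 ^+ w * r ^+ k * c) by ring.
  by rewrite ler_piMr // mulr_ge0 ?ler0n.
Qed.
End ConstantWeightCode.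

(** Here [X] is the set of words of the chosen weight and [m] is [2 ^ w]; the random construction
    needs only these counts. *)
Lemma exists_spread_code k : exists (X : finType) (c : X -> {ffun 'I_k -> bool}) (m : nat),
  [/\ 0 < #|X|,
   forall y, #|[set ab : X * X | word_or (c ab.1) (c ab.2) == y]| * 2 ^ k
      <= k.+1 ^ 2 * #|X| ^ 2,
   forall a y, #|[pred b | word_or (c a) (c b) == y]| <= m &
   m ^ 2 * 2 ^ k <= k.+1 ^ 2 * #|X| ^ 2].
Proof.
have [w [X0 hM hS]] := exists_balanced_weight k.
pose X : finType := {a : {ffun 'I_k -> bool} | weight a == w}.
exists X, val, (2 ^ w).
have cX : #|X| = #|[set a : {ffun 'I_k -> bool} | weight a == w]|.
  by rewrite card_sig cardsE.
rewrite cX; split=> // [y | a y].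
  apply: leq_trans (hM y); rewrite leq_mul2r; apply/orP; right.
  pose h (ab : X * X) := (val ab.1, val ab.2).
  have h_inj : injective h by move=> [a b] [a' b'] [/val_inj -> /val_inj ->].
  rewrite -(card_imset _ h_inj); apply: subset_leq_card.
  apply/subsetP=> z /imsetP[[a b]]; rewrite !inE /= => ab ->.
  by rewrite /= (valP a) (valP b).
have wa : weight (val a) = w by apply/eqP/(valP a).
apply: leq_trans (_ : 2 ^ weight (val a) <= _); last by rewrite wa.
apply: leq_trans (card_word_or_fiber (val a) y).
rewrite -(card_imset _ val_inj); apply: subset_leq_card.
by apply/subsetP=> z /imsetP[b]; rewrite !inE => ? ->.
Qed.

(** * Random maps *)

Section RandomMap.
Variables T X Y : finType.
Variable op : X -> X -> Y.
Implicit Types (f g : {ffun T -> X}) (u v : T).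

Definition upd f u (b : X) : {ffun T -> X} := [ffun x => if x == u then b else f x].

Lemma upd_same f u b : upd f u b u = b.
Proof. by rewrite ffunE eqxx. Qed.

Lemma upd_other f u b x : x != u -> upd f u b x = f x.
Proof. by move=> /negbTE xu; rewrite ffunE xu. Qed.

Lemma updK f u b : upd (upd f u b) u (f u) = f.
Proof. by apply/ffunP=> x; rewrite !ffunE; case: eqP => [->|]. Qed.

(* Exchanging the value of f at u with an independent value b is an involution
   of pairs (f, b); it turns the condition on f u into a condition on b. *)
Lemma card_peel1 u (P : pred {ffun T -> X}) (Q : {ffun T -> X} -> pred X) m :
    (forall f b, P (upd f u b) = P f) ->
    (forall f b, Q (upd f u b) =1 Q f) ->
    (forall f, #|Q f| <= m) ->
  #|[pred f | P f && Q f (f u)]| * #|X| <= #|P| * m.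
Proof.
move=> Pu Qu Qm.
pose A := [set z : {ffun T -> X} * X | P z.1 && Q z.1 (z.1 u)].
pose B := [set z : {ffun T -> X} * X | P z.1 && Q z.1 z.2].
have -> : #|[pred f | P f && Q f (f u)]| * #|X| = #|A|.
  rewrite -cardX; apply: eq_card => -[f b]; rewrite !inE /=.
  by rewrite andbT.
pose h (z : {ffun T -> X} * X) := (upd z.1 u z.2, z.1 u).
have hK : involutive h by case=> f b; rewrite /h /= updK upd_same.
have -> : #|A| = #|B|.
  rewrite -(card_imset A (inv_inj hK)); apply: eq_card => z.
  rewrite -[z in LHS]hK mem_imset ?inE; last exact: inv_inj.
  by case: z => f b; rewrite /h /= Pu Qu upd_same.
rewrite -sum1_card (eq_bigl (fun z => P z.1 && Q z.1 z.2)); last by move=> z; rewrite inE.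
rewrite -(pair_big_dep P (fun f b => Q f b) (fun _ _ => 1)) /=.
rewrite -sum_nat_const; apply: leq_sum => f _.
by rewrite sum1_card.
Qed.

(** The same exchange, made at two vertices at once against an independent pair; as [u != v], the
    two updates do not interfere. *)
Lemma card_peel2 u v (P : pred {ffun T -> X}) (Q : rel X) m :
    u != v ->
    (forall f b, P (upd f u b) = P f) -> (forall f b, P (upd f v b) = P f) ->
    #|[set ab : X * X | Q ab.1 ab.2]| <= m ->
  #|[pred f | P f && Q (f u) (f v)]| * #|X| ^ 2 <= #|P| * m.
Proof.
move=> uv Pu Pv Qm.
pose A := [set z : {ffun T -> X} * (X * X) | P z.1 && Q (z.1 u) (z.1 v)].
pose B := [set z : {ffun T -> X} * (X * X) | P z.1 && Q z.2.1 z.2.2].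
have -> : #|[pred f | P f && Q (f u) (f v)]| * #|X| ^ 2 = #|A|.
  rewrite -mulnn -card_prod -cardX; apply: eq_card => -[f b]; rewrite !inE /=.
  by rewrite andbT.
pose h (z : {ffun T -> X} * (X * X)) :=
  (upd (upd z.1 u z.2.1) v z.2.2, (z.1 u, z.1 v)).
have hK : involutive h.
  case=> f [a b]; rewrite /h /=; congr (_, (_, _)).
  - apply/ffunP=> x; rewrite !ffunE.
    by case: eqP => [->|_] //; case: eqP => [->|].
  - by rewrite upd_other // upd_same.
  - by rewrite upd_same.
have -> : #|A| = #|B|.
  rewrite -(card_imset A (inv_inj hK)); apply: eq_card => z.
  rewrite -[z in LHS]hK mem_imset ?inE; last exact: inv_inj.
  by case: z => f [a b]; rewrite /h /= Pv Pu upd_same upd_other // upd_same.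
apply: leq_trans (leq_mul (leqnn _) Qm).
rewrite -[X in _ <= X * _]cardsE -cardsX; apply: subset_leq_card; apply/subsetP=> -[f [a b]].
by rewrite !inE.
Qed.

(** The leaves are peeled off one by one while the value at the centre stays fixed; [m] is uniform
    in that value, so each leaf contributes a factor [m / #|X|]. *)
Lemma card_star_event v (y : Y) m (s : seq T) :
    uniq (v :: s) -> (forall a, #|[pred b | op a b == y]| <= m) ->
  #|[pred f : {ffun T -> X} | all (fun u => op (f v) (f u) == y) s]| * #|X| ^ size s
    <= #|{ffun T -> X}| * m ^ size s.
Proof.
move=> + hm; elim: s => [_ | u s IH] /=.
  by rewrite !muln1 max_card.
rewrite inE negb_or => /and3P[/andP[vu vs] us uniq_s].
have {}IH := IH _; rewrite /= vs uniq_s /= in IH.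
pose P := [pred f : {ffun T -> X} | all (fun u => op (f v) (f u) == y) s].
pose Q f b := op (f v) b == y.
have Pu f b : P (upd f u b) = P f.
  apply: eq_in_all => x xs; rewrite !upd_other //.
  by apply: contraNneq us => <-.
have Qu f b : Q (upd f u b) =1 Q f by move=> c; rewrite /Q upd_other.
have := card_peel1 Pu Qu (fun f => hm (f v)).
rewrite (eq_card (B := [pred f : {ffun T -> X} |
   (op (f v) (f u) == y) && all (fun u0 => op (f v) (f u0) == y) s])); last first.
  by move=> f; rewrite !inE andbC.
move=> h1; rewrite !expnS mulnA; apply: leq_trans (leq_mul h1 (leqnn _)) _.
by rewrite mulnAC mulnCA mulnC leq_mul // IH.
Qed.

(** [uniq (endpoints s)] expresses that the pairs in [s] form a matching. *)
Definition endpoints (s : seq (T * T)) := flatten [seq [:: e.1; e.2] | e <- s].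

(** Disjoint pairs depend on disjoint sets of values of [f], so they can be peeled off one by
    one. *)
Lemma card_matching_event (y : Y) m (s : seq (T * T)) :
    uniq (endpoints s) -> #|[set ab : X * X | op ab.1 ab.2 == y]| <= m ->
  #|[pred f : {ffun T -> X} | all (fun e => op (f e.1) (f e.2) == y) s]|
      * (#|X| ^ 2) ^ size s <= #|{ffun T -> X}| * m ^ size s.
Proof.
move=> + hm; elim: s => [_ | [u v] s IH] /=.
  by rewrite !muln1 max_card.
rewrite inE negb_or => /and3P[/andP[uv us] vs uniq_s].
have {}IH := IH uniq_s.
pose P := [pred f : {ffun T -> X} | all (fun e => op (f e.1) (f e.2) == y) s].
pose Q a b := op a b == y.
have indep x : x \notin endpoints s -> forall f b, P (upd f x b) = P f.
  move=> xs f b; apply: eq_in_all => e es.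
  by rewrite !upd_other //; apply: contraNneq xs => <-; apply/flattenP;
    exists [:: e.1; e.2]; rewrite ?inE ?eqxx ?orbT // (map_f (fun e : T * T => [:: e.1; e.2])).
have := card_peel2 (Q := Q) uv (indep u us) (indep v vs) hm.
rewrite (eq_card (B := [pred f : {ffun T -> X} |
   (op (f u) (f v) == y) && all (fun e => op (f e.1) (f e.2) == y) s])); last first.
  by move=> f; rewrite !inE andbC.
move=> h1; rewrite expnS [m ^ _]expnS mulnA; apply: leq_trans (leq_mul h1 (leqnn _)) _.
by rewrite mulnAC mulnCA mulnC leq_mul // IH.
Qed.
End RandomMap.

(** * Union bound and first moment method *)

Lemma union_bound (F : finType) (I : eqType) (r : seq I) (A : I -> pred F) c m :
    (forall i, i \in r -> #|A i| * c <= m) ->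
  #|[pred f | has (fun i => A i f) r]| * c <= size r * m.
Proof.
elim: r => [_ | i r IH hA] /=; first by rewrite mul0n eq_card0 ?mul0n.
apply: leq_trans (_ : (#|A i| + #|[pred f | has (fun i => A i f) r]|) * c <= _).
  rewrite leq_mul2r -cardUI; apply/orP; right; apply: leq_trans (leq_addr _ _).
  by apply: subset_leq_card; apply/subsetP=> f; rewrite !inE.
rewrite mulnDl mulSn leq_add ?hA ?mem_head // IH // => j jr.
by rewrite hA // inE jr orbT.
Qed.

Fixpoint words (T : Type) n (A : seq T) : seq (seq T) :=
  if n is n'.+1 then [seq x :: t | x <- A, t <- words n' A] else [:: [::]].

Lemma size_words (T : Type) n (A : seq T) : size (words n A) = size A ^ n.
Proof. by elim: n => //= n IH; rewrite size_allpairs IH expnS. Qed.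

Lemma mem_words (T : eqType) (A s : seq T) :
  all [in A] s -> s \in words (size s) A.
Proof.
elim: s => //= x s IH /andP[xA sA]; apply/allpairsP.
by exists (x, s); rewrite /= IH.
Qed.

(* First moment method: the expected numbers of monochromatic L-matchings and
   of monochromatic L-stars are both less than 1/2. *)
Lemma exists_spread_map (T X Y : finType) (op : X -> X -> Y) (R : {set T * T})
    (W : {set T}) (A B D L m : nat) :
    0 < #|X| ->
    (forall y, #|[set ab : X * X | op ab.1 ab.2 == y]| * A <= B * #|X| ^ 2) ->
    (forall a y, #|[pred b | op a b == y]| <= m) -> m ^ 2 * A <= B * #|X| ^ 2 ->
    (forall v, #|[set u | (v, u) \in R]| <= D) ->
    2 * (#|R| ^ L * #|Y| * B ^ L) < A ^ L ->
    4 * ((#|W| * #|Y|) ^ 2 * (D ^ 2 * B) ^ L) < A ^ L ->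
  exists f : {ffun T -> X},
    (forall s y, size s = L -> {subset s <= R} -> uniq (endpoints s) ->
       ~~ all (fun e => op (f e.1) (f e.2) == y) s) /\
    (forall v s y, v \in W -> size s = L -> {subset s <= [set u | (v, u) \in R]} ->
       uniq (v :: s) -> ~~ all (fun u => op (f v) (f u) == y) s).
Proof.
move=> X0 hM hS hm hD ltM ltS.
pose F := {ffun T -> X}.
have F0 : 0 < #|{: F}| by rewrite card_ffun expn_gt0 X0.
pose rM := [seq (s, y) | s <- words L (enum R), y <- enum Y].
(* A list that is not a matching of size [L] gets the empty event, so the union bound may run over
   all words. *)
pose badM (i : seq (T * T) * Y) : pred F := [pred f : F |
  [&& size i.1 == L, uniq (endpoints i.1) & all (fun e => op (f e.1) (f e.2) == i.2) i.1]].
pose BM := [pred f | has (fun i => badM i f) rM].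
have cBM : 2 * #|BM| < #|{: F}|.
  have bM i : i \in rM -> #|badM i| * A ^ L <= B ^ L * #|{: F}|.
    move=> _; case: i => s y; rewrite /badM /=.
    have [/andP[/eqP <- us] | nok] := boolP ((size s == L) && uniq (endpoints s)); last first.
      by rewrite [X in X * _]eq_card0 // => f; rewrite !inE andbA (negbTE nok).
    have := card_matching_event us (leqnn #|[set ab : X * X | op ab.1 ab.2 == y]|).
    set c := #|[pred f : F | all _ s]|; set P := #|[set ab | _]| => hc.
    rewrite (eq_card (B := [pred f : F | all (fun e => op (f e.1) (f e.2) == y) s]))
      -/c; last first.
      by move=> f; rewrite !inE eqxx us.
    have XX : 0 < (#|X| ^ 2) ^ size s by rewrite !expn_gt0 X0.
    rewrite -(leq_pmul2r XX).
    have -> : c * A ^ size s * (#|X| ^ 2) ^ size s = c * (#|X| ^ 2) ^ size s * A ^ size s by lia.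
    apply: leq_trans (leq_mul hc (leqnn _)) _.
    rewrite [B ^ _ * _]mulnC -!mulnA -!expnMn leq_mul2l; apply/orP; right.
    by case: (size s) => // l; rewrite leq_exp2r //; apply: hM.
  have := union_bound bM; rewrite -/BM => hU.
  have Al : 0 < A ^ L by apply: leq_ltn_trans ltM.
  rewrite -(ltn_pmul2r Al) -mulnA.
  apply: leq_ltn_trans (leq_mul (leqnn 2) hU) _.
  rewrite size_allpairs size_words -!cardE [_ * A ^ L]mulnC mulnA mulnA ltn_pmul2r //.
  by rewrite -!mulnA in ltM *.
pose bS v (i : seq T * Y) : pred F := [pred f : F |
  [&& size i.1 == L, uniq (v :: i.1) & all (fun u => op (f v) (f u) == i.2) i.1]].
pose rS v := [seq (s, y) | s <- words L (enum [set u | (v, u) \in R]), y <- enum Y].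
pose bad v : pred F := [pred f | has (fun i => bS v i f) (rS v)].
pose BS := [pred f | has (fun v => bad v f) (enum W)].
have cBS : 2 * #|BS| < #|{: F}|.
  have bSi v i : #|bS v i| * #|X| ^ L <= #|{: F}| * m ^ L.
    case: i => s y; rewrite /bS /=.
    have [/andP[/eqP <- us] | nok] := boolP ((size s == L) && uniq (v :: s)); last first.
      by rewrite [X in X * _]eq_card0 // => f; rewrite !inE andbA (negbTE nok).
    apply: leq_trans (card_star_event us (hS ^~ y)).
    by rewrite leq_mul2r subset_leq_card ?orbT //; apply/subsetP=> f; rewrite !inE => /and3P[].
  have bad_le v : #|bad v| * #|X| ^ L <= D ^ L * #|Y| * (#|{: F}| * m ^ L).
    apply: leq_trans (union_bound (fun i _ => bSi v i)) _.
    rewrite size_allpairs size_words -!cardE !leq_mul //.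
    by case: (L) => // l; rewrite leq_exp2r //; apply: hD.
  have := union_bound (r := enum W) (fun v _ => bad_le v); rewrite -/BS -cardE => hU.
  have XL : 0 < #|X| ^ L by rewrite expn_gt0 X0.
  have Al : 0 < A ^ L by apply: leq_ltn_trans ltM.
  (* The hypotheses control [m ^ 2] rather than [m], so the inequality is proved for the squares. *)
  rewrite -ltn_sqr.
  have Z : 0 < (#|X| ^ L) ^ 2 * A ^ L by rewrite muln_gt0 expn_gt0 XL.
  rewrite -(ltn_pmul2r Z).
  set b := #|BS| in hU *; set n := #|{: F}| in hU F0 *.
  have hU2 : (b * #|X| ^ L) ^ 2 <= (#|W| * (D ^ L * #|Y| * (n * m ^ L))) ^ 2 by rewrite leq_sqr.
  apply: leq_ltn_trans (_ : 4 * (#|W| * (D ^ L * #|Y| * (n * m ^ L))) ^ 2 * A ^ L < _).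
    rewrite (_ : (2 * b) ^ 2 * ((#|X| ^ L) ^ 2 * A ^ L) = 4 * (b * #|X| ^ L) ^ 2 * A ^ L); last lia.
    by rewrite leq_mul // leq_mul.
  have pw a : (a ^ L) ^ 2 = (a ^ 2) ^ L by rewrite -!expnM mulnC.
  apply: leq_ltn_trans (_ : (#|X| ^ L) ^ 2 * n ^ 2 * (4 * ((#|W| * #|Y|) ^ 2 * (D ^ 2 * B) ^ L)) < _).
    rewrite (_ : 4 * (#|W| * (D ^ L * #|Y| * (n * m ^ L))) ^ 2 * A ^ L =
      4 * (#|W| * #|Y|) ^ 2 * n ^ 2 * ((D ^ L) ^ 2) * ((m ^ L) ^ 2 * A ^ L)); last lia.
    rewrite (_ : (#|X| ^ L) ^ 2 * n ^ 2 * (4 * ((#|W| * #|Y|) ^ 2 * (D ^ 2 * B) ^ L)) =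
      4 * (#|W| * #|Y|) ^ 2 * n ^ 2 * ((D ^ L) ^ 2) * ((#|X| ^ L) ^ 2 * B ^ L)); last first.
      by rewrite [(D ^ 2 * B) ^ L]expnMn -pw; lia.
    rewrite leq_mul2l; apply/orP; right.
    rewrite !pw -!expnMn; case: (L) => // l; rewrite leq_exp2r //.
    by rewrite [X in _ <= X]mulnC.
  rewrite (_ : n ^ 2 * ((#|X| ^ L) ^ 2 * A ^ L) = (#|X| ^ L) ^ 2 * n ^ 2 * A ^ L); last lia.
  by rewrite ltn_pmul2l // muln_gt0 !expn_gt0 X0 F0.
(* Each of the two bad sets contains less than half of the maps, so some map avoids both. *)
have [f /norP[nM nS]] : exists f : F, ~~ (BM f || BS f).
  apply/existsP; apply: contraT; rewrite negb_exists => /forallP hall.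
  have cU : #|[predU BM & BS]| = #|{: F}|.
    by apply: eq_card => f; rewrite !inE; have := hall f; rewrite negbK.
  have : #|[predU BM & BS]| <= #|BM| + #|BS| by rewrite -cardUI leq_addr.
  by move: cBM cBS; rewrite cU; move: #|BM| #|BS| #|{: F}| => x y z; lia.
exists f; split=> [s y sL sR us | v s y vW sL sR us].
  apply: contra nM => all_s; apply/hasP; exists (s, y); last by rewrite /badM /= sL us eqxx.
  apply/allpairsP; exists (s, y); rewrite mem_enum -sL; split=> //.
  by apply: mem_words; apply/allP=> x xs; rewrite mem_enum sR.
apply: contra nS => all_s; apply/hasP; exists v; first by rewrite mem_enum.
apply/hasP; exists (s, y); last by rewrite /bS /= sL all_s eqxx andbT.
apply/allpairsP; exists (s, y); rewrite mem_enum -sL; split=> //.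
by apply: mem_words; apply/allP=> x xs; rewrite mem_enum sR.
Qed.

(** * Identification in rounds *)

Section Strategies.
Variable T : finType.
Implicit Types (E : {set {set T}}) (d e : {set T}) (r : seq {set T}).

Definition same_outcomes E r (y : seq bool) : {set {set T}} :=
  [set e in E | map (outcome e) r == y].

(** [E] holds the edges still compatible with the earlier outcomes, [m] is the number of rounds left
    and [t] the remaining budget. Adaptivity lies in the order of quantifiers: the later rounds are
    chosen after [y]. *)
Fixpoint identifiable (m : nat) E (t : nat) : Prop :=
  if m is m'.+1 then
    exists r, size r <= t /\ forall y, identifiable m' (same_outcomes E r y) (t - size r)
  else #|E| <= 1.

Lemma same_outcomes_sub E r y : same_outcomes E r y \subset E.
Proof. by apply/subsetP=> e; rewrite inE => /andP[]. Qed.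

Lemma identifiable_sub m E E' t t' :
  E' \subset E -> t <= t' -> identifiable m E t -> identifiable m E' t'.
Proof.
elim: m E E' t t' => [|m IH] E E' t t' sE tt' /=.
  exact: leq_trans (subset_leq_card sE).
move=> [r [rt hr]]; exists r; split; first exact: leq_trans tt'.
move=> y; apply: IH (hr y); last by rewrite leq_sub2r.
by apply/subsetP=> e; rewrite !inE => /andP[/(subsetP sE) -> ->].
Qed.

Lemma identifiableS m E t : identifiable m E t -> identifiable m.+1 E t.
Proof.
move=> h; exists [::]; split=> // y; rewrite subn0.
exact: identifiable_sub (same_outcomes_sub _ _ _) (leqnn _) h.
Qed.

Lemma identifiable_le1 m E t : #|E| <= 1 -> identifiable m E t.
Proof. by move=> E1; elim: m => // m; apply: identifiableS. Qed.

Lemma identifiable_cons m E t t' r :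
    size r <= t -> (forall y, identifiable m (same_outcomes E r y) t') ->
  identifiable m.+1 E (t + t').
Proof.
move=> rt hr; exists r; split; first exact: leq_trans (leq_addr _ _).
move=> y; apply: identifiable_sub (hr y) => //; lia.
Qed.

Lemma identifiable1 E t r : size r <= t ->
    (forall e e', e \in E -> e' \in E -> map (outcome e) r = map (outcome e') r -> e = e') ->
  identifiable 1 E t.
Proof.
move=> rt hr; exists r; split=> // y; apply/card_le1P => e.
rewrite inE => /andP[eE /eqP ey] e'; rewrite !inE.
apply/idP/eqP => [/andP[e'E /eqP e'y] | ->]; last by rewrite eE ey eqxx.
by apply: hr; rewrite ?ey.
Qed.

(** Choice turns the nested existential statements into the functions [round2] and [round3] of the
    outcomes. *)
Lemma identifiable_three_stage E t : identifiable 3 E t ->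
  exists A : three_stage T, identifies A E /\ forall d, d \in E -> num_tests A d <= t.
Proof.
move=> /= [r1 [r1t h1]].
pose r2 y := proj1_sig (constructive_indefinite_description _ (h1 y)).
have h2 y : size (r2 y) <= t - size r1 /\ forall y', identifiable 1
   (same_outcomes (same_outcomes E r1 y) (r2 y) y') (t - size r1 - size (r2 y)).
  exact: proj2_sig (constructive_indefinite_description _ (h1 y)).
pose r3 y y' := proj1_sig (constructive_indefinite_description _ (proj2 (h2 y) y')).
have h3 y y' : size (r3 y y') <= t - size r1 - size (r2 y) /\ forall z,
   #|same_outcomes (same_outcomes (same_outcomes E r1 y) (r2 y) y') (r3 y y') z| <= 1.
  exact: proj2_sig (constructive_indefinite_description _ (proj2 (h2 y) y')).
exists (ThreeStage r1 r2 r3); split=> [d d' dE d'E e1 e2 e3 | d dE].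
  set A := ThreeStage r1 r2 r3 in e1 e2 e3.
  have [_ /(_ (outs3 A d))] := h3 (outs1 A d) (outs2 A d).
  move/card_le1_eqP; apply; last by rewrite !inE dE !eqxx.
  have e2' : map (outcome d') (r2 (outs1 A d)) = outs2 A d by rewrite e2 e1.
  have e3' : map (outcome d') (r3 (outs1 A d) (outs2 A d)) = outs3 A d by rewrite e3 e2 e1.
  by rewrite !inE d'E e2' e3' e1 !eqxx.
have := proj1 (h2 (outs1 (ThreeStage r1 r2 r3) d)).
have := proj1 (h3 (outs1 (ThreeStage r1 r2 r3) d) (outs2 (ThreeStage r1 r2 r3) d)).
rewrite /num_tests /=; lia.
Qed.

(** * Basic strategies: single vertices, binary codes, stars *)

Lemma outcome_set1 e v : outcome e [set v] = (v \in e).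
Proof. by rewrite /outcome disjoints1 negbK. Qed.

Lemma card_cover_edges E : simple_edge_set E -> #|cover E| <= 2 * #|E|.
Proof.
move=> sE; apply: leq_trans (leq_card_cover E) _.
by rewrite mulnC -sum_nat_const; apply: eq_leq; apply: eq_bigr => e /sE.
Qed.

(** Testing every covered vertex alone reveals the edge. *)
Lemma identifiable_vertices E : simple_edge_set E -> identifiable 1 E (2 * #|E|).
Proof.
move=> sE; apply: (@identifiable1 _ _ [seq [set v] | v <- enum (cover E)]).
  by rewrite size_map -cardE card_cover_edges.
move=> e e' eE e'E; rewrite -!map_comp => /eq_in_map h; apply/setP=> v.
have [vE | vE] := boolP (v \in cover E).
  by have /= := h v; rewrite mem_enum !outcome_set1; apply.
have out d : d \in E -> (v \in d) = false.
  by move=> dE; apply: contraNF vE => vd; apply/bigcupP; exists d.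
by rewrite !out.
Qed.

(** Vertices of [B] get distinct codes in [{set 'I_t}], and test [i] contains those whose code has
    [i]; an edge with a single vertex in [B] reveals the code of that vertex. *)
Lemma binary_tests (B : {set T}) t : #|B| <= 2 ^ t ->
  exists2 r, size r = t & forall e e', #|e :&: B| = 1 -> #|e' :&: B| = 1 ->
    map (outcome e) r = map (outcome e') r -> e :&: B = e' :&: B.
Proof.
move=> Bt; pose c v := nth set0 (enum {set 'I_t}) (index v (enum B)).
have c_inj : {in B &, injective c}.
  have card_enum : size (enum {set 'I_t}) = 2 ^ t.
    by rewrite -cardE -cardsT -powersetT card_powerset cardsT card_ord.
  have lt_idx v : v \in B -> index v (enum B) < size (enum {set 'I_t}).
    by move=> vB; rewrite card_enum; apply: leq_trans Bt; rewrite cardE index_mem mem_enum.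
  move=> u v uB vB /eqP; rewrite nth_uniq ?lt_idx ?enum_uniq // => /eqP uv.
  by rewrite -(nth_index u (_ : u \in enum B)) ?uv ?nth_index ?mem_enum.
exists [seq [set v in B | i \in c v] | i <- enum 'I_t].
  by rewrite size_map size_enum_ord.
have out e x i : e :&: B = [set x] -> outcome e [set v in B | i \in c v] = (i \in c x).
  move=> ex; have : x \in e :&: B by rewrite ex set11.
  rewrite inE => /andP[xe xB].
  apply/pred0Pn/idP => [[v] | ix]; last by exists x; rewrite /= !inE xB ix.
  rewrite /= !inE => /andP[/andP[vB iv] ve].
  have : v \in e :&: B by rewrite inE ve.
  by rewrite ex inE => /eqP <-.
move=> e e' /eqP/cards1P[x ex] /eqP/cards1P[x' ex'].
rewrite -[LHS]map_comp -[RHS]map_comp => /eq_in_map h; rewrite ex ex'; congr [set _].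
apply: c_inj.
- by have := set11 x; rewrite -ex inE => /andP[].
- by have := set11 x'; rewrite -ex' inE => /andP[].
apply/setP=> i; have /= := h i; rewrite mem_enum => /(_ isT).
by rewrite (out _ _ _ ex) (out _ _ _ ex').
Qed.

Lemma card2_other e v : #|e| = 2 -> v \in e -> exists2 u, u != v & e = [set v; u].
Proof.
move=> e2 ve; have : #|e :\ v| == 1 by have := cardsD1 v e; rewrite ve e2 add1n => -[<-].
case/cards1P=> u eu; exists u.
  by have := set11 u; rewrite -eu !inE => /andP[].
by rewrite -(setD1K ve) eu.
Qed.

(** An edge through [v] is determined by its other end, and distinct ends belong to distinct edges,
    so binary tests on these ends suffice. *)
Lemma identifiable_star E v t : simple_edge_set E ->
  (forall e, e \in E -> v \in e) -> #|E| <= 2 ^ t -> identifiable 1 E t.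
Proof.
move=> sE vE Et; pose U := cover E :\ v.
have eU e : e \in E -> e :&: U = e :\ v.
  move=> eE; apply/setP=> u; rewrite !inE; case: (boolP (u \in e)); rewrite ?andbF // => ue.
  by rewrite !andbT /= (_ : u \in cover E) ?andbT //; apply/bigcupP; exists e.
have Ut : #|U| <= 2 ^ t.
  apply: leq_trans Et; pose h u := [set v; u].
  rewrite -(card_in_imset (f := h) (D := [in U])).
    apply: subset_leq_card; apply/subsetP=> _ /imsetP[u + ->].
    rewrite !inE => /andP[uv /bigcupP[e eE ue]].
    have [u' u'v e_def] := card2_other (sE _ eE) (vE _ eE).
    by move: ue eE; rewrite e_def !inE (negbTE uv) /= => /eqP ->.
  move=> u u'; rewrite !inE => /andP[uv _] /andP[u'v _] /setP/(_ u).
  by rewrite !inE eqxx orbT (negbTE uv) /= => /esym/eqP.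
have [r rt hr] := binary_tests Ut.
apply: (@identifiable1 _ _ r); first by rewrite rt.
have card1 e : e \in E -> #|e :&: U| = 1.
  by move=> eE; rewrite eU //; have := cardsD1 v e; rewrite (vE _ eE) (sE _ eE) add1n => -[].
move=> e e' eE e'E /(hr _ _ (card1 _ eE) (card1 _ e'E)).
by rewrite !eU // => ee; rewrite -(setD1K (vE _ eE)) ee setD1K ?vE.
Qed.

(** The first round finds the endpoint in [B] by its code; the edges left form a star at that
    vertex. *)
Lemma identifiable_cross E (B : {set T}) t t' : simple_edge_set E ->
    (forall e, e \in E -> #|e :&: B| = 1) -> #|B| <= 2 ^ t ->
    (forall v, v \in B -> #|[set e in E | v \in e]| <= 2 ^ t') ->
  identifiable 2 E (t + t').
Proof.
move=> sE eB Bt degB; have [r rt hr] := binary_tests Bt.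
apply: (@identifiable_cons _ _ _ _ r); first by rewrite rt.
move=> y; set E' := same_outcomes _ _ _.
have sE' : E' \subset E by apply: same_outcomes_sub.
have [->|[e0 e0E']] := set_0Vmem E'; first by apply: identifiable_le1; rewrite cards0.
have [v ev] := cards1P (introT eqP (eB _ (subsetP sE' _ e0E'))).
have vB : v \in B by have := set11 v; rewrite -ev inE => /andP[].
have vE' e : e \in E' -> v \in e.
  move=> eE'; have : e :&: B = [set v].
    rewrite -ev; apply: hr; rewrite ?eB ?(subsetP sE') //.
    by move: eE' e0E'; rewrite !inE => /andP[_ /eqP ->] /andP[_ /eqP ->].
  by move=> eBv; have := set11 v; rewrite -eBv inE => /andP[].
apply: (@identifiable_star _ v) => //.
  by move=> e /(subsetP sE')/sE.
apply: leq_trans (degB _ vB); apply: subset_leq_card; apply/subsetP=> e eE'.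
by rewrite inE (subsetP sE') ?vE'.
Qed.
End Strategies.

(** * Edges inside one degree class, and the three rounds *)

Section Graphs.
Variable T : finType.
Implicit Types (E : {set {set T}}) (e : {set T}) (u v : T).

Definition edges_at E v := [set e in E | v \in e].

Lemma simple_sub E E' : E' \subset E -> simple_edge_set E -> simple_edge_set E'.
Proof. by move=> /subsetP sE h e /sE/h. Qed.

Lemma edge_neq E u v : simple_edge_set E -> [set u; v] \in E -> u != v.
Proof. by move=> sE /sE; rewrite cards2; case: eqP. Qed.

Lemma set2_inj v u u' : u != v -> [set v; u] = [set v; u'] -> u = u'.
Proof.
move=> uv /setP/(_ u); rewrite !inE eqxx orbT (negbTE uv) /=.
by move/esym/eqP.
Qed.

(** Greedy choice: removing all edges that meet a chosen one deletes at most [2 * L] edges. *)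
Lemma exists_matching E L m : simple_edge_set E ->
    (forall v, #|edges_at E v| <= L) -> 2 * L * m < #|E| ->
  exists s : seq (T * T),
    [/\ size s = m, uniq (endpoints s) & forall p, p \in s -> [set p.1; p.2] \in E].
Proof.
elim: m E => [|m IH] E sE degE ltE; first by exists [::].
have [e eE] : exists e, e \in E by apply/card_gt0P; apply: leq_ltn_trans ltE.
have [u ue] : exists u, u \in e by apply/card_gt0P; rewrite sE.
have [v vu e_def] := card2_other (sE _ eE) ue.
pose E' := E :\: (edges_at E u :|: edges_at E v).
have sE' : E' \subset E by apply: subsetDl.
have [|v'||s [ss us sE's]] := IH E'; first exact: simple_sub sE.
- apply: leq_trans (degE v'); apply: subset_leq_card; apply/subsetP=> d.
  by rewrite !inE => /andP[/andP[_ ->] ->].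
- have := cardsID (edges_at E u :|: edges_at E v) E; rewrite -/E'.
  have := subset_leq_card (subsetIr E (edges_at E u :|: edges_at E v)).
  have := cardsUI (edges_at E u) (edges_at E v).
  have := degE u; have := degE v; lia.
have avoid x : x \in e -> x \notin endpoints s.
  move=> xe; apply/negP=> /flattenP[_ /mapP[p ps ->]] xp.
  have := sE's _ ps; rewrite !inE negb_or => /andP[/andP[nu nv] pE].
  move: xe nu nv; rewrite pE e_def !inE /=.
  by case/orP=> /eqP <-; move: xp; rewrite !inE /= => ->.
exists ((u, v) :: s); split=> /=; first by rewrite ss.
  by rewrite us !inE negb_or eq_sym vu !avoid // e_def !inE eqxx ?orbT.
move=> p; rewrite inE => /orP[/eqP -> /= | /sE's]; first by rewrite -e_def.
exact: (subsetP sE').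
Qed.

Lemma card_neighbours E v : simple_edge_set E ->
  #|[set u | [set v; u] \in E]| = #|edges_at E v|.
Proof.
move=> sE; rewrite -(card_in_imset (f := fun u => [set v; u])).
  apply: eq_card => e; rewrite inE; apply/imsetP/andP=> [[u + ->] | [eE ve]].
    by rewrite !inE eqxx.
  by have [u _ e_def] := card2_other (sE _ eE) ve; exists u; rewrite ?inE -?e_def.
move=> u u'; rewrite !inE => /(edge_neq sE) vu _; apply: set2_inj.
by rewrite eq_sym.
Qed.

Lemma sum_card_edges E : simple_edge_set E -> \sum_(e in E) #|e| = 2 * #|E|.
Proof.
by move=> sE; rewrite mulnC -sum_nat_const; apply: eq_bigr => e /sE.
Qed.

Lemma sum_degrees E : simple_edge_set E -> \sum_v #|edges_at E v| = 2 * #|E|.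
Proof.
move=> sE; rewrite -sum_card_edges //.
under eq_bigr do rewrite -sum1_card.
under [RHS]eq_bigr do rewrite -sum1_card.
rewrite (exchange_big_dep [in E]) /=; last by move=> v e _; rewrite inE => /andP[].
by apply: eq_bigr => e eE; apply: eq_bigl => v; rewrite inE eE.
Qed.

Lemma card_arcs E : simple_edge_set E ->
  #|[set p : T * T | [set p.1; p.2] \in E]| = 2 * #|E|.
Proof.
move=> sE; rewrite -sum_degrees // -sum1_card.
rewrite (eq_bigl (fun p : T * T => [set p.1; p.2] \in E)); last by move=> p; rewrite inE.
rewrite -(pair_big_dep xpredT (fun u v => [set u; v] \in E) (fun _ _ => 1)) /=.
apply: eq_bigr => v _; rewrite -card_neighbours // -sum1_card.
by apply: eq_bigl => u; rewrite inE.
Qed.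

(** Without large stars and matchings at most [2 * L * L] edges stay compatible, and their vertices
    are then tested singly. The bound on [2 ^ w] absorbs the factor [k.+1 ^ 2]; the bound on [w * L]
    makes the gain over [L] edges beat the union bound. *)
Lemma identifiable_random E n w L D :
    simple_edge_set E -> #|E| <= 2 ^ n ->
    (forall v, #|edges_at E v| <= D) -> D ^ 2 <= 2 ^ (n + 1 + w) ->
    2 * (n + 3 * w).+1 ^ 2 <= 2 ^ w -> 4 + 4 * n + 6 * w < w * L ->
  identifiable 2 E (n + 3 * w + 2 * (2 * L * L)).
Proof.
move=> sE En degE Dn kw wL; set k := n + 3 * w in kw *.
have [X [c [m [X0 hM hS hm]]]] := exists_spread_code k.
pose op a b := word_or (c a) (c b).
pose R := [set p : T * T | [set p.1; p.2] \in E].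
have nbR v : [set u | (v, u) \in R] = [set u | [set v; u] \in E].
  by apply/setP=> u; rewrite !inE.
have cY : #|{: {ffun 'I_k -> bool}}| = 2 ^ k by rewrite card_ffun card_bool card_ord.
have L0 : 0 < L by case: (L) wL; rewrite ?muln0.
have [||||f [noM noS]] :=
  @exists_spread_map T X _ op R (cover E) (2 ^ k) (k.+1 ^ 2) D L m X0 hM _ hm.
- by move=> a y; apply: hS.
- by move=> v; rewrite nbR card_neighbours.
(* Matchings: [2 * #|E| * k.+1 ^ 2] is at most [2 ^ (n + w)], against [2 ^ (n + 3 * w)], a gain of
   [2 ^ (2 * w)] per arc. *)
- rewrite cY card_arcs // mulnAC -expnMn -expnM.
  apply: leq_ltn_trans (_ : 2 * ((2 ^ (n + w)) ^ L * 2 ^ k) < _).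
    by rewrite !leq_mul // leq_exp2r // expnD -mulnA mulnCA leq_mul.
  rewrite -expnM -!expnD -expnS ltn_exp2l // /k; nia.
(* Stars: the gain is [2 ^ w] per leaf after squaring, while the choice of centre and outcome costs
   [2 ^ (4 + 4 * n + 6 * w)] in all. *)
- rewrite cY -expnM.
  apply: leq_ltn_trans (_ : 4 * ((2 ^ (n + 1) * 2 ^ k) ^ 2 * (2 ^ (n + 2 * w)) ^ L) < _).
    apply: leq_mul => //; apply: leq_mul.
      rewrite leq_sqr leq_mul2r; apply/orP; right.
      by apply: leq_trans (card_cover_edges sE) _; rewrite expnD mulnC leq_mul.
    rewrite leq_exp2r //; apply: leq_trans (leq_mul Dn (leqnn _)) _.
    have -> : n + 1 + w = (n + w) + 1 by lia.
    have -> : n + 2 * w = (n + w) + w by lia.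
    by rewrite !(expnD 2 (n + w)) expn1 -mulnA leq_mul.
  rewrite -expnD -!expnM -expnD -(expnD 2 2) ltn_exp2l // /k; nia.
(* The outcomes on an edge spell the disjunction of the words at its two ends. *)
pose r := [seq [set v | c (f v) i] | i <- enum 'I_k].
apply: (@identifiable_cons _ _ _ _ _ r); first by rewrite size_map size_enum_ord.
move=> y; set E' := same_outcomes E r y.
have sE' : E' \subset E by apply: same_outcomes_sub.
have simE' := simple_sub sE' sE.
have out u v i : outcome [set u; v] [set x | c (f x) i] = op (f u) (f v) i.
  rewrite ffunE; apply/pred0Pn/orP => [[x] | ].
    by rewrite /= !inE => /andP[cx /orP[] /eqP <-]; [left | right].
  by case=> h; [exists u | exists v]; rewrite /= !inE h eqxx ?orbT.
(* All compatible edges share the disjunction [z], which is arbitrary if there is no such edge. *)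
have [z op_z] : exists z, forall u v, [set u; v] \in E' -> op (f u) (f v) = z.
  have [E0|[e0 e0E']] := set_0Vmem E'.
    by exists [ffun=> false] => u v; rewrite E0 inE.
  have [u0 u0e] : exists u, u \in e0 by apply/card_gt0P; rewrite simE'.
  have [v0 _ e_def] := card2_other (simE' _ e0E') u0e.
  exists (op (f u0) (f v0)) => u v uvE'; apply/ffunP=> i; rewrite -!out -e_def.
  move: e0E' uvE'; rewrite !inE => /andP[_ /eqP <-] /andP[_].
  rewrite /r -[X in X == _]map_comp -[X in _ == X]map_comp => /eqP/eq_in_map/(_ i) /=.
  by rewrite mem_enum; apply.
have degE' v : #|edges_at E' v| <= L.
  apply: contraT; rewrite -ltnNge -card_neighbours // => ltL.
  pose s := take L (enum [set u | [set v; u] \in E']).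
  have sU u : u \in s -> [set v; u] \in E' by move/mem_take; rewrite mem_enum inE.
  have ss : size s = L by rewrite size_takel // -cardE ltnW.
  have us : uniq (v :: s).
    rewrite /= take_uniq ?enum_uniq // andbT; apply/negP=> /sU/(edge_neq simE').
    by rewrite eqxx.
  have vE : v \in cover E.
    have /card_gt0P[u] := leq_ltn_trans (leq0n L) ltL.
    rewrite inE => /(subsetP sE') uE; apply/bigcupP; exists [set v; u] => //.
    by rewrite !inE eqxx.
  have sR : {subset s <= [set u | (v, u) \in R]}.
    by move=> u /sU/(subsetP sE'); rewrite nbR inE.
  have := noS v s z vE ss sR us; case/allPn=> u /sU/op_z ->.
  by rewrite eqxx.
apply: identifiable_sub (subxx _) _ (identifiable_vertices simE').
rewrite leq_mul2l /= leqNgt; apply/negP=> ltE'.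
have [s [ss us sE's]] := exists_matching simE' degE' ltE'.
have sR : {subset s <= R} by move=> p /sE's/(subsetP sE'); rewrite inE.
have := noM s z ss sR us; case/allPn=> p /sE's/op_z ->.
by rewrite eqxx.
Qed.

(** After the [s] class tests, an edge between two classes costs
    [(n + 1 - j * w) + j.+1 * w = n + 1 + w] tests and an edge inside one class costs the random
    scheme; the bound covers both. *)
Lemma identifiable_three E n w s L :
    simple_edge_set E -> #|E| <= 2 ^ n -> n < w * s ->
    2 * (n + 3 * w).+1 ^ 2 <= 2 ^ w -> 4 + 4 * n + 6 * w < w * L ->
  identifiable 3 E (s + (n + 3 * w + 1 + 2 * (2 * L * L))).
Proof.
move=> sE En ns kw wL.
have w0 : 0 < w by case: (w) ns; rewrite ?mul0n.
pose deg v := #|edges_at E v|.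
pose level v := trunc_log 2 (deg v) %/ w.
(* Isolated vertices are kept out of class 0, where they would violate the lower degree bound. *)
pose B j := [set v | (0 < deg v) && (level v == j)].
have deg_gt0 e v : e \in E -> v \in e -> 0 < deg v.
  by move=> eE ve; apply/card_gt0P; exists e; rewrite inE eE.
have deg_le v : deg v <= 2 ^ n.
  apply: leq_trans En; apply: subset_leq_card; apply/subsetP=> e.
  by rewrite inE => /andP[].
have B_lo j v : v \in B j -> 2 ^ (j * w) <= deg v.
  rewrite inE => /andP[d0 /eqP <-]; have /andP[+ _] := trunc_log_bounds (isT : 1 < 2) d0.
  by apply: leq_trans; rewrite leq_exp2l // leq_trunc_div.
have B_hi j v : v \in B j -> deg v <= 2 ^ (j.+1 * w).
  rewrite inE => /andP[d0 /eqP <-]; have /andP[_ /ltnW] := trunc_log_bounds (isT : 1 < 2) d0.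
  by move/leq_trans; apply; rewrite leq_exp2l // ltn_ceil.
have jw_le j v : v \in B j -> j * w <= n.
  by move=> /B_lo /leq_trans /(_ (deg_le v)); rewrite leq_exp2l.
have level_lt v : 0 < deg v -> level v < s.
  move=> d0; have /jw_le : v \in B (level v) by rewrite inE d0 eqxx.
  by move=> h; have := leq_ltn_trans h ns; rewrite [w * s]mulnC ltn_pmul2r.
have card_B j v : v \in B j -> #|B j| <= 2 ^ (n + 1 - j * w).
  move=> vB; have jwn := jw_le _ _ vB.
  have p0 : 0 < 2 ^ (j * w) by rewrite expn_gt0.
  rewrite -(leq_pmul2r p0) -expnD subnK; last by lia.
  apply: leq_trans (_ : 2 * #|E| <= _); last by rewrite expnD mulnC leq_mul.
  rewrite -sum_degrees // -sum_nat_const [X in X <= _]big_mkcond.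
  by apply: leq_sum => u _; case: ifP => // /B_lo.
pose r := [seq B j | j <- iota 0 s].
apply: (@identifiable_cons _ _ _ _ _ r); first by rewrite size_map size_iota.
move=> y; set E1 := same_outcomes E r y.
have sE1 : E1 \subset E by apply: same_outcomes_sub.
have simE1 := simple_sub sE1 sE.
have inB e v : e \in E1 -> v \in e -> v \in B (level v).
  by move=> /(subsetP sE1) eE ve; rewrite inE eqxx (deg_gt0 e).
have degE1 v : #|edges_at E1 v| <= deg v.
  apply: subset_leq_card; apply/subsetP=> e; rewrite !inE => /andP[/andP[-> _] ->] //.
(* Equal outcomes in round 1 mean that all compatible edges meet the same classes. *)
have hit e e' v : e \in E1 -> e' \in E1 -> v \in e -> exists2 v', v' \in e' & v' \in B (level v).
  move=> eE1 e'E1 ve; have vB := inB _ _ eE1 ve.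
  have lt : level v < s by apply: level_lt; move: vB; rewrite inE => /andP[].
  move: (eE1) (e'E1); rewrite !inE => /andP[_ /eqP <-] /andP[_].
  rewrite /r -[X in X == _]map_comp -[X in _ == X]map_comp => /eqP/eq_in_map/(_ (level v)).
  rewrite mem_iota lt => /(_ isT) /= h.
  have : outcome e' (B (level v)).
    by rewrite h; apply/pred0Pn; exists v; rewrite /= vB ve.
  by case/pred0Pn=> v' /= /andP[v'B v'e']; exists v'.
have [->|[e0 e0E1]] := set_0Vmem E1; first by apply: identifiable_le1; rewrite cards0.
have [v ve0] : exists v, v \in e0 by apply/card_gt0P; rewrite simE1.
have [u uv e0_def] := card2_other (simE1 _ e0E1) ve0.
have ue0 : u \in e0 by rewrite e0_def !inE eqxx orbT.
pose j := level v; have vB : v \in B j by apply: inB ve0.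
(* The levels of the two ends of the sample edge [e0] decide the strategy for all compatible
   edges. *)
have [uj | uj] := eqVneq (level u) j; last first.
  apply: (@identifiable_sub _ _ E1 E1 ((n + 1 - j * w) + j.+1 * w)) => //.
    by have := jw_le _ _ vB; lia.
  apply: (@identifiable_cross _ _ (B j)) => //; last 2 first.
  - exact: card_B vB.
  - by move=> x xB; apply: leq_trans (degE1 x) (B_hi _ _ xB).
  (* A compatible edge also meets the class of [u], which is disjoint from [B j], so just one of its
     two vertices lies in [B j]. *)
  move=> e eE1; have [x xe xB] := hit _ _ _ e0E1 eE1 ve0.
  have [z ze zB] := hit _ _ _ e0E1 eE1 ue0.
  have zB' : z \notin B j by move: zB; rewrite !inE => /andP[-> /eqP ->].
  apply/eqP/cards1P; exists x.
  have [x' x'x e_def] := card2_other (simE1 _ eE1) xe.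
  have zx' : z = x'.
    move: ze; rewrite e_def !inE => /orP[] /eqP // zx.
    by rewrite zx xB in zB'.
  apply/setP=> t; rewrite in_setI in_set1 e_def !inE -zx'.
  have [->|] := eqVneq t x; first by move: xB; rewrite inE => ->.
  by move=> _ /=; have [->|//] := eqVneq t z; move: zB'; rewrite inE => /negbTE ->.
have subB e x : e \in E1 -> x \in e -> x \in B j.
  move=> eE1 xe; have [x' x'e0 x'B] := hit _ _ _ eE1 e0E1 xe.
  have xB := inB _ _ eE1 xe.
  suff <- : level x = j by [].
  move: x'B; rewrite inE => /andP[_ /eqP <-].
  by move: x'e0; rewrite e0_def !inE => /orP[] /eqP ->.
have jwn := jw_le _ _ vB.
(* Degrees inside the class are bounded both by the degrees in the graph and by the size of [B j];
   in the product of the two bounds [j * w] cancels. *)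
pose D := minn (2 ^ (j.+1 * w)) (2 ^ (n + 1 - j * w)).
apply: (@identifiable_sub _ _ E1 E1 (n + 3 * w + 2 * (2 * L * L))) => //; first by lia.
apply: (@identifiable_random _ _ _ _ D) => //.
- exact: leq_trans (subset_leq_card sE1) En.
- move=> x; have [xB | xB] := boolP (x \in B j).
    rewrite leq_min (leq_trans (degE1 x) (B_hi _ _ xB)) /=.
    apply: leq_trans (card_B _ _ vB); rewrite -card_neighbours //.
    apply: subset_leq_card; apply/subsetP=> t; rewrite inE => h.
    by apply: subB h _; rewrite !inE eqxx orbT.
  rewrite (_ : edges_at E1 x = set0) ?cards0 //; apply/setP=> e; rewrite !inE.
  by apply/negP=> /andP[eE1 xe]; rewrite (subB e) // inE in xB.
- rewrite -mulnn; apply: leq_trans (leq_mul (geq_minl _ _) (geq_minr _ _)) _.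
  by rewrite -expnD leq_exp2l //; lia.
Qed.
End Graphs.

(** * Asymptotics *)

(** With [m] a quarter of [w], [w] is at most [2 ^ (m + 2)] and [c] at most [2 ^ (m - 3)], which
    leaves room for the square. *)
Lemma sqr_le_exp2 c w : 4 * c + 12 <= w -> 2 * (w * c) ^ 2 <= 2 ^ w.
Proof.
move=> cw; pose m := w %/ 4.
have w_lt : w <= 2 ^ (m + 2).
  have := ltn_expl m (isT : 1 < 2); have := ltn_ceil w (isT : 0 < 4); rewrite -/m expnD; lia.
have c_lt : c <= 2 ^ (m - 3).
  apply: ltnW; apply: leq_trans (ltn_expl c (isT : 1 < 2)) _.
  rewrite leq_exp2l // /m; lia.
apply: leq_trans (_ : 2 * (2 ^ (m + 2) * 2 ^ (m - 3)) ^ 2 <= _).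
  by rewrite leq_mul // leq_sqr leq_mul.
rewrite -expnD -expnM -expnS leq_exp2l // /m; lia.
Qed.

(** For fixed [s] the relative overhead is about [3 / s]: [w] grows like [n / s], while [L] does not
    depend on [n]. *)
Lemma identifiable_asymptotic s : 0 < s -> exists C n0, forall n, n0 <= n ->
  forall (T : finType) (E : {set {set T}}), simple_edge_set E -> #|E| <= 2 ^ n ->
  identifiable 3 E (n + 3 * (n %/ s) + C).
Proof.
(* The term [4 * s] pays for [4 + 4 * n], as [n < w * s]; the 11 exceeds the 6 of [6 * w]. *)
move=> s0; pose L := 4 * s + 11.
exists (s + 4 + 2 * (2 * L * L)), (s * (4 * (s + 4) + 12)) => n hn T E sE En.
pose w := (n %/ s).+1.
have nw : n < w * s by apply: ltn_ceil.
have w_ge : 4 * (s + 4) + 12 <= w by rewrite ltnW // ltnS leq_divRL // mulnC.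
have w1 : 0 < w by [].
apply: (@identifiable_sub _ _ E E (s + (n + 3 * w + 1 + 2 * (2 * L * L)))) => //.
  by rewrite /w; lia.
apply: identifiable_three => //.
  apply: leq_trans (sqr_le_exp2 w_ge); rewrite leq_mul // leq_sqr; nia.
rewrite /L; nia.
Qed.

(** One budget for all graphs with [N] edges, because the error term may depend on [N] only. *)
Definition suffices N t := forall (T : finType) (E : {set {set T}}),
  simple_edge_set E -> #|E| = N -> identifiable 3 E t.

Lemma suffices_double N : suffices N (2 * N).
Proof.
by move=> T E sE <-; do 2 apply: identifiableS; apply: identifiable_vertices.
Qed.

Lemma exists_optimum N : exists t, suffices N t /\ forall t', suffices N t' -> t <= t'.
Proof.
pose b t : bool := if excluded_middle_informative (suffices N t) then true else false.
have bP t : reflect (suffices N t) (b t).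
  by rewrite /b; case: excluded_middle_informative => h; constructor.
have ex : exists t, b t by exists (2 * N); apply/bP; apply: suffices_double.
case: (ex_minnP ex) => t /bP ht tmin; exists t; split=> // t' /bP; exact: tmin.
Qed.

(* Binary logarithms and the limit of the error term *)
From Stdlib Require Import Reals Lra.
From mathcomp Require Import ssrnat.

Local Open Scope R_scope.

Lemma INR_exp2 n : INR (2 ^ n)%N = 2 ^ n.
Proof. by elim: n => //= n IH; rewrite expnS mult_INR IH. Qed.

Lemma log2R_exp2 n : log2R (2 ^ n) = INR n.
Proof.
have l2 : 0 < ln 2 by apply: Rlt_trans ln_lt_2; lra.
by rewrite /log2R ln_pow; [field | ]; lra.
Qed.

Lemma log2R_le x y : 0 < x -> x <= y -> log2R x <= log2R y.
Proof.
move=> x0 xy; have l2 : 0 < ln 2 by apply: Rlt_trans ln_lt_2; lra.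
apply: Rmult_le_compat_r; first by apply: Rlt_le; apply: Rinv_0_lt_compat.
by case: xy => [xy | ->]; [apply: Rlt_le; apply: ln_increasing | apply: Rle_refl].
Qed.

Lemma exp2_le_log2R N n : (2 ^ n <= N)%N -> INR n <= log2R (INR N).
Proof.
move=> nN; rewrite -log2R_exp2; apply: log2R_le; first by apply: pow_lt; lra.
by rewrite -INR_exp2; apply: le_INR; apply/leP.
Qed.

Lemma up_log_le_log2R N : (1 < N)%N -> INR (up_log 2 N) <= log2R (INR N) + 1.
Proof.
move=> N1; have /andP[lo _] := up_log_bounds (isT : (1 < 2)%N) N1.
have up0 : (0 < up_log 2 N)%N by rewrite up_log_gt0.
rewrite -(prednK up0) S_INR; apply: Rplus_le_compat_r.
by apply: exp2_le_log2R; apply: ltnW.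
Qed.

Theorem theorem3 :
  exists eps : nat -> R, Un_cv eps 0%R /\
    forall (T : finType) (E : {set {set T}}), simple_edge_set E ->
      exists A : three_stage T, identifies A E /\
        forall d, d \in E ->
          (INR (num_tests A d) <= log2R (INR #|E|) * (1 + eps #|E|))%R.
Proof.
pose opt N := proj1_sig (constructive_indefinite_description _ (exists_optimum N)).
have optP N : suffices N (opt N) /\ forall t, suffices N t -> (opt N <= t)%N.
  exact: proj2_sig (constructive_indefinite_description _ (exists_optimum N)).
(* The relative excess of the optimal budget, cut off at 0 so that convergence only needs an upper
   bound. *)
exists (fun N => Rmax 0 (INR (opt N) / log2R (INR N) - 1)); split; last first.
  move=> T E sE; have [le1 | E1] := leqP #|E| 1.
    (* With at most one edge no test is made, and the logarithm of 1 is 0. *)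
    move: (le1) => /(@identifiable_le1 _ 3 _ 0)/identifiable_three_stage[A [idA numA]].
    exists A; split=> // d dE; have := numA d dE; rewrite leqn0 => /eqP ->.
    have E1 : #|E| = 1%N.
      by apply/eqP; rewrite eqn_leq le1 /=; apply/card_gt0P; exists d.
    by rewrite E1 /log2R /= ln_1; lra.
  have [A [idA numA]] := identifiable_three_stage ((optP #|E|).1 T E sE erefl).
  exists A; split=> // d dE.
  have l1 : 1 <= log2R (INR #|E|) by apply: (@exp2_le_log2R _ 1).
  apply: Rle_trans (_ : INR (opt #|E|) <= _); first by apply: le_INR; apply/leP/numA.
  have := Rmax_r 0 (INR (opt #|E|) / log2R (INR #|E|) - 1).
  set l := log2R _ in l1 *; set M := Rmax _ _ => hM.
  apply: Rle_trans (_ : l * (INR (opt #|E|) / l) <= _); first by right; field; lra.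
  by apply: Rmult_le_compat_l; lra.
move=> e e0.
(* Half of [e] pays for the overhead [3 * (n %/ s)]. *)
have [s [s0 hs]] : exists s, (0 < s)%N /\ 3 / INR s < e / 2.
  have [s hs] := INR_unbounded (6 / e); exists s.
  have p6 : 0 < 6 / e by apply: Rdiv_lt_0_compat; lra.
  have sR : 0 < INR s by lra.
  split; first by apply/ltP; apply: INR_lt.
  apply: (Rmult_lt_reg_r (INR s)) => //.
  have -> : 3 / INR s * INR s = 6 / e * (e / 2) by field; lra.
  by rewrite [X in _ < X]Rmult_comm; apply: Rmult_lt_compat_r; lra.
have [C [n0 hC]] := identifiable_asymptotic s0.
(* The other half pays for the constant [C] and for rounding the logarithm up, once it exceeds
   [K]. *)
have [K hK] := INR_unbounded ((1 + e / 2 + INR C) / (e / 2)).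
exists (2 ^ (n0 + K).+1)%N => N /leP hN.
have N1 : (1 < N)%N.
  apply: leq_trans hN; rewrite -[X in (X < _)%N](expn0 2) ltn_exp2l //.
have n_ge : (n0 <= up_log 2 N)%N.
  have := leq_trans hN (up_logP N (isT : (1 < 2)%N)); rewrite leq_exp2l //; lia.
have suff_n : suffices N (up_log 2 N + 3 * (up_log 2 N %/ s) + C).
  by move=> T E sE EN; apply: hC => //; rewrite EN up_logP.
have := (optP N).2 _ suff_n; have := up_log_le_log2R N1.
have : INR K < log2R (INR N).
  apply: Rlt_le_trans (exp2_le_log2R hN); apply: lt_INR; lia.
set l := log2R _; set n := up_log 2 N => lK nl /leP/le_INR.
have sR : 0 < INR s by apply: lt_0_INR; apply/ltP.
have dR : 3 * INR (n %/ s) <= e / 2 * INR n.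
  apply: Rle_trans (_ : 3 / INR s * INR n <= _).
    have : INR (n %/ s) * INR s <= INR n.
      by rewrite -mult_INR; apply: le_INR; apply/leP; apply: leq_trunc_div.
    move=> h; have -> : 3 / INR s * INR n = 3 * (INR n / INR s) by field; lra.
    apply: Rmult_le_compat_l; first lra.
    apply: (Rmult_le_reg_r (INR s)) => //.
    by have -> : INR n / INR s * INR s = INR n by field; lra.
  by apply: Rmult_le_compat_r; [apply: pos_INR | lra].
rewrite 2!plus_INR mult_INR => hopt.
have C0 := pos_INR C.
have K0 : 1 + e / 2 + INR C < e / 2 * l.
  have -> : 1 + e / 2 + INR C = e / 2 * ((1 + e / 2 + INR C) / (e / 2)) by field; lra.
  by apply: Rmult_lt_compat_l; lra.
have l0 : 0 < l by have := pos_INR K; lra.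
(* The optimum is at most [(1 + e / 2) * n + C] with [n <= l + 1], and [K0] bounds the remaining
   constant by [e / 2 * l]. *)
have opt_lt : INR (opt N) < (1 + e) * l.
  have : INR n * (e / 2) <= (l + 1) * (e / 2) by apply: Rmult_le_compat_r; lra.
  by move: hopt; rewrite /=; lra.
rewrite /R_dist Rminus_0_r Rabs_pos_eq; last exact: Rmax_l.
apply: Rmax_lub_lt => //.
suff : INR (opt N) / l < 1 + e by lra.
by apply: (Rmult_lt_reg_r l) => //; have -> : INR (opt N) / l * l = INR (opt N) by field; lra.
Qed.
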